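(* In the finite-window setting of the context, assume the following. (1) Quotient lifting: there are constants $0\le\varepsilon_G<1$ and $\delta_G\ge0$ such that for every $\mathfrak D\in\mathcal U^{\mathrm{loc}}_\Lambda$ and every $b\in\mathcal C^{\mathrm{cl}}_\Lambda$ there is $a\in\mathcal C^{\mathrm{loc}}_\Lambda$ with \[ \|\mathfrak D-G^{\mathrm{loc}}_\Lambda a\|_{\mathrm{loc}}\le\frac1{1-\varepsilon_G}\|\Theta_\Lambda\mathfrak D-G^{\mathrm{cl}}_\Lambda b\|_{\mathrm{cl}}+\frac{\delta_G}{1-\varepsilon_G}. \] (2) Componentwise detection: for every $\mathfrak D\in\mathcal U^{\mathrm{loc}}_\Lambda$, \[ \|O^{\mathrm{loc}}_\Lambda\mathfrak D\|\ge\|O^{\mathrm{cl}}_\Lambda\Theta_\Lambda\mathfrak D\|-(\mathsf{Err}_{\mathrm{prs}}+\mathsf{Err}_{\mathrm{loc}}+\mathsf{Err}_{\mathrm{tr}}+\mathsf{Err}_{\mathrm{gauge}})(\mathfrak D), \] \[ C_E\|\mathcal E^{\mathrm{loc}}_\Lambda(\mathfrak D)\|\ge C_E\|\mathcal E^{\mathrm{cl}}_\Lambda(\Theta_\Lambda\mathfrak D)\|-\mathsf{Err}_{\mathrm{nl}}(\mathfrak D),\qquad C_R\mathsf{Rep}^{\mathrm{loc}}_\Lambda(\mathfrak D)\ge C_R\mathsf{Rep}^{\mathrm{cl}}_\Lambda(\Theta_\Lambda\mathfrak D)-\mathsf{Err}_{\mathrm{rep}}(\mathfrak D), \] \[ [\mathsf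 P^{\mathrm{loc}}_\Lambda(\mathfrak D)]_+\ge[\mathsf P^{\mathrm{cl}}_\Lambda(\Theta_\Lambda\mathfrak D)]_+-\mathsf{Err}_{\mathrm{prof}}(\mathfrak D). \] (3) Normalized errors: for each $q\in\{\mathrm{prs},\mathrm{loc},\mathrm{tr},\mathrm{nl},\mathrm{rep},\mathrm{gauge},\mathrm{prof}\}$ there are $\eta_q,\Delta_q\ge0$ with $\mathsf{Err}_q(\mathfrak D)\le\eta_q\operatorname{dist}_{\mathrm{loc}}(\mathfrak D,\operatorname{Im}G^{\mathrm{loc}}_\Lambda)+\Delta_q$ for all $\mathfrak D\in\mathcal U^{\mathrm{loc}}_\Lambda$; put $\eta_\Lambda=\sum_q\eta_q$, $\Delta_\Lambda=\sum_q\Delta_q$. (4) Clean gap: there is $c^{\mathrm{cl}}_\Lambda>0$ with $\|\mathcal F^{\mathrm{cl}}_\Lambda(d)\|_{\mathrm{cl}}\ge c^{\mathrm{cl}}_\Lambda\operatorname{dist}_{\mathrm{cl}}(d,\operatorname{Im}G^{\mathrm{cl}}_\Lambda)$ for all $d\in\Theta_\Lambda(\mathcal U^{\mathrm{loc}}_\Lambda)$. If $\eta_\Lambda<c^{\mathrm{cl}}_\Lambda(1-\varepsilon_G)$, then every $\mathfrak D\in\mathcal U^{\mathrm{loc}}_\Lambda$ satisfies \[ \|O^{\mathrm{loc}}_\Lambda\mathfrak D\|+C_E\|\mathcal E^{\mathrm{loc}}_\Lambda(\mathfrak D)\|+C_R\mathsf{Rep}^{\mathrm{loc}}_\Lambda(\mathfrak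 D)+[\mathsf P^{\mathrm{loc}}_\Lambda(\mathfrak D)]_+\ \ge\ c^{\mathrm{loc}}_\Lambda\operatorname{dist}_{\mathrm{loc}}(\mathfrak D,\operatorname{Im}G^{\mathrm{loc}}_\Lambda)-\Delta'_\Lambda, \] where $c^{\mathrm{loc}}_\Lambda=c^{\mathrm{cl}}_\Lambda(1-\varepsilon_G)-\eta_\Lambda>0$ and $\Delta'_\Lambda=\Delta_\Lambda+c^{\mathrm{cl}}_\Lambda\delta_G$. Equivalently, \[ \|O^{\mathrm{loc}}_\Lambda\mathfrak D\|+C_E\|\mathcal E^{\mathrm{loc}}_\Lambda(\mathfrak D)\|+C_R\mathsf{Rep}^{\mathrm{loc}}_\Lambda(\mathfrak D)\ \ge\ c^{\mathrm{loc}}_\Lambda\operatorname{dist}_{\mathrm{loc}}(\mathfrak D,\operatorname{Im}G^{\mathrm{loc}}_\Lambda)-[\mathsf P^{\mathrm{loc}}_\Lambda(\mathfrak D)]_+-\Delta'_\Lambda. \]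
   Context: Finite-window setting. $\Lambda$ is a fixed finite window. $\mathcal D^{\mathrm{loc}}_\Lambda$ and $\mathcal D^{\mathrm{cl}}_\Lambda$ (localized and clean defect spaces) are finite-dimensional normed spaces with norms $\|\cdot\|_{\mathrm{loc}}$, $\|\cdot\|_{\mathrm{cl}}$. For $\bullet\in\{\mathrm{loc},\mathrm{cl}\}$, $\mathcal C^\bullet_\Lambda$ is a finite-dimensional normed space and $G^\bullet_\Lambda:\mathcal C^\bullet_\Lambda\to\mathcal D^\bullet_\Lambda$ is a cleaning map; $\operatorname{dist}_\bullet(d,\operatorname{Im}G^\bullet_\Lambda)=\inf_{a\in\mathcal C^\bullet_\Lambda}\|d-G^\bullet_\Lambda a\|_\bullet$. The local-to-clean chart is a map $\Theta_\Lambda:\mathcal U^{\mathrm{loc}}_\Lambda\to\mathcal D^{\mathrm{cl}}_\Lambda$ on a chart domain $\mathcal U^{\mathrm{loc}}_\Lambda\subseteq\mathcal D^{\mathrm{loc}}_\Lambda$, given as a composition of six continuous maps (core restriction, cutoff flattening, harmonic-gauge projection, periodization, clean projection, coordinate extraction) through finite-dimensional normed intermediate spaces. Detection data: for $\bullet\in\{\mathrm{loc},\mathrm{cl}\}$, $O^\bullet_\Lambda$ (observation) and $\mathcal E^\bullet_\Lambda$ (equation residual) are maps from $\mathcal D^\bullet_\Lambda$ to normed spaces, $\mathsf{Rep}^\bullet_\Lambda:\mathcal D^\bullet_\Lambda\to[0,\infty)$ is the reproduction residual, and $\mathsf P^\bullet_\Lambda:\mathcal D^\bullet_\Lambda\to\mathbb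 R$ is the profit functional; $C_E,C_R\ge0$ are fixed weights, and $[x]_+=\max\{x,0\}$. The detection norm is \[ \|\mathcal F^\bullet_\Lambda(d)\|_\bullet=\|O^\bullet_\Lambda d\|+C_E\|\mathcal E^\bullet_\Lambda(d)\|+C_R\mathsf{Rep}^\bullet_\Lambda(d)+[\mathsf P^\bullet_\Lambda(d)]_+ . \] Error functionals: $\mathsf{Err}_q:\mathcal U^{\mathrm{loc}}_\Lambda\to[0,\infty)$ for $q\in\{\mathrm{prs},\mathrm{loc},\mathrm{tr},\mathrm{nl},\mathrm{rep},\mathrm{gauge},\mathrm{prof}\}$ (pressure, localization, truncation/trace, nonlinear, reproduction, gauge, profit errors). *)

(* Defs.v *)
From HB Require Import structures.
From mathcomp Require Import all_boot all_order all_algebra.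
From mathcomp Require Import all_classical all_reals topology normedtype.
Set Implicit Arguments.
Unset Strict Implicit.
Unset Printing Implicit Defensive.
Import Order.TTheory GRing.Theory Num.Theory.
Import numFieldNormedType.Exports.
Local Open Scope classical_set_scope.
Local Open Scope ring_scope.

(* A vectType is by definition linearly isomorphic to some 'rV_n; the norm is
   otherwise unconstrained. *)
#[short(type="finNormedModType")]
HB.structure Definition FinNormedModule (K : numFieldType) :=
  {V of NormedModule K V & Vector K V}.

(* No linearity of [G] is assumed. The set is nonempty and bounded below by 0,
   so the real-valued [inf] is the genuine infimum. *)
Definition dist_Im (R : realType) (C : Type) (D : normedModType R)
    (G : C -> D) (d : D) : R :=
  inf [set `|d - G a| | a in [set: C]].

Definition pos_part (R : realType) (x : R) : R := Num.max x 0.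

Definition detection_norm (R : realType) (D : Type) (Y Z : normedModType R)
    (C_E C_R : R) (O : D -> Y) (E : D -> Z) (Rep P : D -> R) (d : D) : R :=
  `|O d| + C_E * `|E d| + C_R * Rep d + pos_part (P d).

Inductive error_kind : Set :=
  prs | loc | tr | nl | rep | gauge | prof.

Definition error_kind_enum := [:: prs; loc; tr; nl; rep; gauge; prof].

Definition error_kind_index (q : error_kind) : nat :=
  match q with
  | prs => 0 | loc => 1 | tr => 2 | nl => 3 | rep => 4 | gauge => 5 | prof => 6
  end%N.

Lemma error_kind_indexK : cancel error_kind_index (nth prs error_kind_enum).
Proof. by case. Qed.

HB.instance Definition _ := Countable.copy error_kind
  (can_type error_kind_indexK).

Lemma error_kind_enumP : Finite.axiom error_kind_enum.
Proof. by case. Qed.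

HB.instance Definition _ := isFinite.Build error_kind error_kind_enumP.

(* Main.v *)
(* Taking the infimum over [b] in the quotient lifting gives
   [(1 - epsG) * dist_loc <= dist_cl + deltaG]. The componentwise inequalities
   add up to "local detection norm >= clean detection norm - sum of the errors";
   the clean gap bounds the first term below by [c_cl * dist_cl], and the
   normalized errors are absorbed into [c_loc] and [Delta']. *)
Require Import Defs.
From HB Require Import structures.
From mathcomp Require Import all_boot all_order all_algebra.
From mathcomp Require Import all_classical all_reals topology normedtype.
From mathcomp Require Import lra.
Set Implicit Arguments.
Unset Strict Implicit.
Unset Printing Implicit Defensive.
Import Order.TTheory GRing.Theory Num.Theory.
Import numFieldNormedType.Exports.
Local Open Scope classical_set_scope.
Local Open Scope ring_scope.

Lemma dist_Im_le (R : realType) (C : Type) (D : normedModType R)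
    (G : C -> D) (d : D) (a : C) : dist_Im G d <= `|d - G a|.
Proof.
apply: ge_inf; last by exists a.
by exists 0 => _ [b _ <-]; exact: normr_ge0.
Qed.

(** [C] is pointed so that the set of values is nonempty: the infimum of the empty set is 0 by
    convention, which a positive [x] would exceed. *)
Lemma le_dist_Im (R : realType) (C : pointedType) (D : normedModType R)
    (G : C -> D) (d : D) (x : R) :
  (forall a, x <= `|d - G a|) -> x <= dist_Im G d.
Proof.
move=> xle; apply: lb_le_inf; first by exists `|d - G point|, point.
by move=> _ [a _ <-]; exact: xle.
Qed.

(** The [a] supplied by the lifting depends on [b], but [dist_Im G d] is below [|d - G a|] for any
    [a]; hence the left-hand side is a lower bound valid for every [b]. *)
Lemma dist_Im_lift (R : realType) (C : Type) (C' : pointedType)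
    (D D' : normedModType R) (G : C -> D) (G' : C' -> D') (d : D) (d' : D')
    (eps delta : R) :
  eps < 1 ->
  (forall b, exists a,
     `|d - G a| <= 1 / (1 - eps) * `|d' - G' b| + delta / (1 - eps)) ->
  (1 - eps) * dist_Im G d - delta <= dist_Im G' d'.
Proof.
move=> eps_lt1 lift; have eps'_gt0 : 0 < 1 - eps by rewrite subr_gt0.
apply: le_dist_Im => b; have [a] := lift b.
(* Clearing the common denominator: [(1 - eps) * |d - G a| <= |d' - G' b| + delta]. *)
rewrite mul1r mulrC -mulrDl ler_pdivlMr // mulrC => le_ab.
rewrite lerBlDr; apply: le_trans le_ab.
by rewrite ler_pM2l // dist_Im_le.
Qed.

(** Makes the seven errors separate terms, as they occur in the componentwise inequalities. *)
Lemma sum_error_kind (V : nmodType) (F : error_kind -> V) :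
  \sum_q F q =
  F prs + (F loc + (F tr + (F nl + (F rep + (F gauge + F prof))))).
Proof.
have -> : index_enum error_kind = error_kind_enum.
  by rewrite [index_enum _]unlock [Finite.enum]unlock.
by rewrite !big_cons big_nil addr0.
Qed.

Theorem theorem17p4 (R : realType)
  (Dloc Dcl Cloc Ccl : finNormedModType R)
  (Gloc : Cloc -> Dloc) (Gcl : Ccl -> Dcl)
  (Uloc : set Dloc)
  (V1 V2 V3 V4 V5 : finNormedModType R)
  (core_restriction : Dloc -> V1)
  (cutoff_flattening : V1 -> V2)
  (gauge_projection : V2 -> V3)
  (periodization : V3 -> V4)
  (clean_projection : V4 -> V5)
  (coordinate_extraction : V5 -> Dcl)
  (core_cont : {within Uloc, continuous core_restriction})
  (cutoff_cont : continuous cutoff_flattening)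
  (gauge_cont : continuous gauge_projection)
  (periodization_cont : continuous periodization)
  (clean_cont : continuous clean_projection)
  (extraction_cont : continuous coordinate_extraction)
  (Theta : Dloc -> Dcl)
  (ThetaE : forall D, Uloc D -> Theta D =
     coordinate_extraction (clean_projection (periodization
       (gauge_projection (cutoff_flattening (core_restriction D))))))
  (Yloc Ycl Zloc Zcl : normedModType R)
  (Oloc : Dloc -> Yloc) (Ocl : Dcl -> Ycl)
  (Eloc : Dloc -> Zloc) (Ecl : Dcl -> Zcl)
  (Reploc : Dloc -> R) (Repcl : Dcl -> R)
  (Reploc_ge0 : forall d, 0 <= Reploc d) (Repcl_ge0 : forall d, 0 <= Repcl d)
  (Ploc : Dloc -> R) (Pcl : Dcl -> R)
  (C_E C_R : R) (C_E_ge0 : 0 <= C_E) (C_R_ge0 : 0 <= C_R)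
  (Err : error_kind -> Dloc -> R)
  (Err_ge0 : forall q D, Uloc D -> 0 <= Err q D)
  (* (1) quotient lifting *)
  (epsG deltaG : R)
  (epsG_ge0 : 0 <= epsG) (epsG_lt1 : epsG < 1) (deltaG_ge0 : 0 <= deltaG)
  (lifting : forall D, Uloc D -> forall b : Ccl, exists a : Cloc,
     `|D - Gloc a| <= 1 / (1 - epsG) * `|Theta D - Gcl b|
                      + deltaG / (1 - epsG))
  (* (2) componentwise detection *)
  (detect_O : forall D, Uloc D ->
     `|Oloc D| >= `|Ocl (Theta D)|
                  - (Err prs D + Err loc D + Err tr D + Err gauge D))
  (detect_E : forall D, Uloc D ->
     C_E * `|Eloc D| >= C_E * `|Ecl (Theta D)| - Err nl D)
  (detect_Rep : forall D, Uloc D ->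
     C_R * Reploc D >= C_R * Repcl (Theta D) - Err rep D)
  (detect_P : forall D, Uloc D ->
     pos_part (Ploc D) >= pos_part (Pcl (Theta D)) - Err prof D)
  (* (3) normalized errors *)
  (eta Delta : error_kind -> R)
  (eta_ge0 : forall q, 0 <= eta q) (Delta_ge0 : forall q, 0 <= Delta q)
  (Err_le : forall q D, Uloc D ->
     Err q D <= eta q * dist_Im Gloc D + Delta q)
  (* (4) clean gap *)
  (c_cl : R) (c_cl_gt0 : 0 < c_cl)
  (clean_gap : forall d, (Theta @` Uloc) d ->
     detection_norm C_E C_R Ocl Ecl Repcl Pcl d >= c_cl * dist_Im Gcl d)
  (eta_lt : \sum_q eta q < c_cl * (1 - epsG)) :
  let c_loc := c_cl * (1 - epsG) - \sum_q eta q in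
  let Delta' := \sum_q Delta q + c_cl * deltaG in
  [/\ 0 < c_loc,
      forall D, Uloc D ->
        `|Oloc D| + C_E * `|Eloc D| + C_R * Reploc D + pos_part (Ploc D)
          >= c_loc * dist_Im Gloc D - Delta'
    & forall D, Uloc D ->
        `|Oloc D| + C_E * `|Eloc D| + C_R * Reploc D
          >= c_loc * dist_Im Gloc D - pos_part (Ploc D) - Delta'].
Proof.
move=> c_loc Delta'.
have main D : Uloc D ->
    c_loc * dist_Im Gloc D - Delta' <=
    `|Oloc D| + C_E * `|Eloc D| + C_R * Reploc D + pos_part (Ploc D).
  move=> UD.
  have lift := dist_Im_lift epsG_lt1 (lifting D UD).
  have gap : c_cl * dist_Im Gcl (Theta D) <=
      detection_norm C_E C_R Ocl Ecl Repcl Pcl (Theta D).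
    by apply: clean_gap; exists D.
  have err : \sum_q Err q D <=
      (\sum_q eta q) * dist_Im Gloc D + \sum_q Delta q.
    by rewrite mulr_suml -big_split; apply: ler_sum => q _; exact: Err_le.
  (* Scaling by [c_cl] produces the term [c_cl * dist_Im Gcl (Theta D)] of the clean gap, so that
     the two inequalities chain. *)
  have {lift} := ler_wpM2l (ltW c_cl_gt0) lift.
  move: gap err (detect_O D UD) (detect_E D UD) (detect_Rep D UD) (detect_P D UD).
  (* Only the sum of errors is expanded; the sums of [eta] and [Delta] stay whole, as in [c_loc] and
     [Delta']. *)
  rewrite (sum_error_kind (Err^~ D)) /= /detection_norm /c_loc /Delta'.
  (* After distributing, hypotheses and goal share the products with [dist_Im Gloc D], and the claim
     is linear in them. *)
  rewrite mulrBr mulrA mulrBl; lra.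
split=> [|//|D UD]; first by rewrite subr_gt0.
by have := main D UD; lra.
Qed.
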